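(* Let $u\in C^2(\mathbb{R}^n)^N$ and let $\Omega\subset\subset\mathbb{R}^n$ be open. Then $\Delta_{\top,\infty}u=0$ on $\Omega$ if and only if the flow map $\Phi:\mathbb{R}\times\Xi\to\Omega$, with $\Xi:=\{(x,\xi) : \xi^\top Du(x)\neq 0\}\subseteq\Omega\times\mathbb{S}^{N-1}$, of $$\frac{\partial}{\partial t}\Phi(t,x,\xi)=\xi^\top Du\big(\Phi(t,x,\xi)\big),\qquad \Phi(0,x,\xi)=x,$$ satisfies along trajectories $$\big|Du\big(\Phi(t,x,\xi)\big)\big|=\big|Du(x)\big|,\quad t\in\mathbb{R},\qquad\text{and}\qquad t\mapsto \xi^\top u\big(\Phi(t,x,\xi)\big)\ \text{ is increasing.}$$
   Context: $Du=(D_iu_\alpha)$ is the $N\times n$ gradient matrix of $u:\mathbb{R}^n\to\mathbb{R}^N$; $|P|=(P_{\alpha i}P_{\alpha i})^{1/2}$ is the Euclidean (Frobenius) norm on $N\times n$ matrices; $\mathbb{S}^{N-1}$ is the unit sphere of $\mathbb{R}^N$; $\xi^\top Du(x)$ is the vector of $\mathbb{R}^n$ with components $\xi_\alpha D_iu_\alpha(x)$. $\Omega\subset\subset\mathbb{R}^n$ means that $\Omega$ has compact closure in $\mathbb{R}^n$. Repeated indices are summed (Greek from $1$ to $N$, Latin from $1$ to $n$). The tangential $\infty$-Laplacian is $$(\Delta_{\top,\infty}u)_\alpha := D_iu_\alpha\,D_ju_\beta\,D^2_{ij}u_\beta,\qquad \alpha=1,\dots,N.$$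
   Formalization: The flow need not stay in Ω for all t∈R (u(x)=x on (−1,1)), so Φ(·,x,ξ) is taken as the maximal solution with values in Ω, on an open interval J(x,ξ) containing 0, and ''t∈R'' becomes ''t∈J(x,ξ)''; ''increasing'' is read as strictly increasing. *)

(* Defs.v *)
From HB Require Import structures.
From mathcomp Require Import all_boot all_order all_algebra.
From mathcomp Require Import all_classical all_reals all_analysis.

Set Implicit Arguments.
Unset Strict Implicit.
Unset Printing Implicit Defensive.

Import Order.TTheory GRing.Theory Num.Theory.
Import numFieldNormedType.Exports.

Local Open Scope classical_set_scope.
Local Open Scope ring_scope.

Section Calculus.
Context {R : realType} {n : nat}.

Definition partial (i : 'I_n) (f : 'rV[R]_n -> R) : 'rV[R]_n -> R :=
  'D_(delta_mx 0 i) f.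

Fixpoint class_C (k : nat) (f : 'rV[R]_n -> R) : Prop :=
  continuous f /\
  (if k is k'.+1 then
     forall i, (forall x, derivable f x (delta_mx 0 i)) /\
               class_C k' (partial i f)
   else True).

(* The library norm on matrices is the sup norm, not this one; the two define
   the same topology. *)
Definition enorm {m p : nat} (A : 'M[R]_(m, p)) : R :=
  Num.sqrt (\sum_i \sum_j A i j ^+ 2).

Definition dotv {m : nat} (v w : 'rV[R]_m) : R := \sum_a v 0 a * w 0 a.

End Calculus.

Section TangentialLaplacian.
Context {R : realType} {n N : nat}.
Variable u : 'rV[R]_n -> 'rV[R]_N.

Definition component (a : 'I_N) : 'rV[R]_n -> R := fun x => u x 0 a.

(* Points are row vectors, but Du is the N x n matrix (D_i u_a)_{a,i}, i.e. the
   transpose of the library's 'J u; thus xi^T Du(x) is  xi *m Du x. *)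
Definition Du (x : 'rV[R]_n) : 'M[R]_(N, n) :=
  \matrix_(a < N, i < n) partial i (component a) x.

Definition D2u (x : 'rV[R]_n) (i j : 'I_n) (b : 'I_N) : R :=
  partial i (partial j (component b)) x.

Definition tangential_infty_laplacian (x : 'rV[R]_n) : 'rV[R]_N :=
  \row_(a < N) \sum_(i < n) \sum_(j < n) \sum_(b < N)
    Du x a i * Du x b j * D2u x i j b.

Variable Omega : set 'rV[R]_n.

Definition Xi : set ('rV[R]_n * 'rV[R]_N) :=
  [set p | [/\ Omega p.1, enorm p.2 = 1 & p.2 *m Du p.1 != 0]].

Definition trajectory (x : 'rV[R]_n) (xi : 'rV[R]_N)
    (I : set R) (gamma : R -> 'rV[R]_n) : Prop :=
  [/\ open I, is_interval I, I 0, gamma 0 = x &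
      forall t, I t ->
        Omega (gamma t) /\ is_derive t 1 gamma (xi *m Du (gamma t))].

(* The integral curves of y |-> xi^T Du(y) may leave Omega in finite time, so
   t |-> Phi t x xi is the maximal solution in Omega, defined for t in the open
   interval J x xi. Solutions being unique for u of class C^2, u and Omega
   determine J on Xi, and Phi t x xi for t in J x xi; other values are junk. *)
Definition is_flow_map (J : 'rV[R]_n -> 'rV[R]_N -> set R)
    (Phi : R -> 'rV[R]_n -> 'rV[R]_N -> 'rV[R]_n) : Prop :=
  forall x xi, Xi (x, xi) ->
    trajectory x xi (J x xi) (fun t => Phi t x xi) /\
    (forall I gamma, trajectory x xi I gamma -> I `<=` J x xi).

End TangentialLaplacian.

(* Main.v *)
(* Put v = xi^T Du(g) along a solution g of g' = xi^T Du(g). The chain rule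
   gives (xi . u(g))' = |v|^2 and (|Du(g)|^2)' = 2 xi . Delta u(g). If Delta u = 0
   then |Du| is constant along trajectories, and v never vanishes: a zero of v
   would be a rest point of the field, which no other trajectory reaches, by
   uniqueness. Conversely, constancy of |Du| gives xi . Delta u(x) = 0 for all
   unit xi with xi^T Du(x) <> 0; for the other xi it holds because
   xi . Delta u(x) depends linearly on xi^T Du(x). The flow itself comes from
   the Picard-Lindelof theorem, since y |-> xi^T Du(y) is of class C^1 and hence
   locally Lipschitz. *)
Require Import Defs.
From mathcomp Require Import all_boot all_order all_algebra.
From mathcomp Require Import all_classical all_reals all_analysis.
From mathcomp Require Import ring lra.
Import Order.TTheory GRing.Theory Num.Theory.
Import numFieldNormedType.Exports.
Local Open Scope classical_set_scope.
Local Open Scope ring_scope.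

Set Implicit Arguments.
Unset Strict Implicit.
Unset Printing Implicit Defensive.

(** * Sup norm and derivatives of curves *)

Lemma coord_le_norm (R : realType) (n : nat) (v : 'rV[R]_n) (i : 'I_n) :
  `|v 0 i| <= `|v|.
Proof.
rewrite [leRHS]/Num.Def.normr/= mx_normrE.
exact: (le_bigmax _ (fun ij : 'I_1 * 'I_n => `|v ij.1 ij.2|) (0, i)).
Qed.

Lemma norm_le_coord (R : realType) (n : nat) (v : 'rV[R]_n) (c : R) :
  0 <= c -> (forall i, `|v 0 i| <= c) -> `|v| <= c.
Proof.
move=> c0 vc; rewrite [leLHS]/Num.Def.normr/= mx_normrE.
by rewrite (bigmax_le _ c0)//= => -[i j] _ /=; rewrite ord1.
Qed.

Lemma is_derive_coord (R : realType) (n : nat) (g : R -> 'rV[R]_n) (t : R)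
    (v : 'rV[R]_n) (i : 'I_n) :
  is_derive t 1 g v -> is_derive t 1 (fun s => g s 0 i) (v 0 i).
Proof.
move=> [dg <-]; apply: DeriveDef; first by move/derivable_mxP : dg; exact.
by rewrite derive_mx// mxE.
Qed.

Lemma is_derive_row (R : realType) (n : nat) (g : R -> 'rV[R]_n) (t : R)
    (v : 'rV[R]_n) :
  (forall i, is_derive t 1 (fun s => g s 0 i) (v 0 i)) -> is_derive t 1 g v.
Proof.
move=> dg; have dgt : derivable g t 1.
  by apply/derivable_mxP => i j; rewrite ord1; have [] := dg j.
apply: DeriveDef => //; rewrite derive_mx//; apply/rowP => i; rewrite mxE.
by have [_ ->] := dg i.
Qed.

Lemma continuous_coord (R : realType) (T : topologicalType) (n : nat)
    (g : T -> 'rV[R]_n) (t : T) (i : 'I_n) :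
  {for t, continuous g} -> {for t, continuous (fun s => g s 0 i)}.
Proof.
move=> gt; apply: (@continuous_comp _ _ _ g (fun v : 'rV[R]_n => v 0 i)) => //.
exact: coord_continuous.
Qed.

(** Derivatives along a real variable become limits of plain difference quotients, free of the
    direction [1] in the library's definition. *)
Lemma is_derive_cvg (R : realType) (V : normedModType R) (f : R -> V) (t : R)
    (l : V) :
  (s^-1 *: (f (s + t) - f t) @[s --> 0^'] --> l) <-> is_derive t 1 f l.
Proof.
have E : (fun s : R => s^-1 *: (f (s + t) - f t)) =
    (fun s : R => s^-1 *: ((f \o shift t) (s *: 1) - f t)).
  by apply/funext => s /=; rewrite scaler1.
rewrite E; split=> [fl|[df <-]]; last exact: df.
by apply: DeriveDef; [exact: cvgP fl|exact: cvg_lim fl].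
Qed.

Lemma is_derive_continuous (R : realType) (V : normedModType R) (f : R -> V)
    (t : R) (l : V) : is_derive t 1 f l -> {for t, continuous f}.
Proof. by move=> [df _]; apply/differentiable_continuous/derivable1_diffP. Qed.

(** The mean value theorem is applied to each coordinate; since the norm is the sup norm, no
    constant is lost. Derivatives are required only inside the interval, so that the bound reaches
    the endpoints [t0 - d] and [t0 + d]. *)
Lemma increment_bound (R : realType) (n : nat) (g dg : R -> 'rV[R]_n)
    (t0 d c : R) :
  0 <= c ->
  (forall s, `|s - t0| <= d -> {for s, continuous g}) ->
  (forall s, `|s - t0| < d -> is_derive s 1 g (dg s)) ->
  (forall s, `|s - t0| < d -> `|dg s| <= c) ->
  forall t, `|t - t0| <= d -> `|g t - g t0| <= c * d.
Proof.
move=> c0 cg dgE dgc t td.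
have d0 : 0 <= d := le_trans (normr_ge0 _) td.
apply: norm_le_coord; first by rewrite mulr_ge0.
move=> i; rewrite !mxE.
have mv a b : a <= b -> `|a - t0| <= d -> `|b - t0| <= d ->
    `|g b 0 i - g a 0 i| <= c * (b - a).
  rewrite le_eqVlt => /predU1P[->|ab] ad bd; first by rewrite !subrr normr0 mulr0.
  have inab s : a <= s <= b -> `|s - t0| <= d.
    move=> /andP[? ?]; move: ad bd; rewrite !ler_norml => /andP[? ?] /andP[? ?].
    by apply/andP; split; lra.
  have inab' s : s \in `]a, b[ -> `|s - t0| < d.
    rewrite in_itv/= => /andP[? ?]; move: ad bd.
    rewrite !ler_norml => /andP[? ?] /andP[? ?].
    by rewrite ltr_norml; apply/andP; split; lra.
  have [s sab|s sab|s sab ->] := @MVT R (fun s => g s 0 i) (fun s => dg s 0 i) a b ab.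
  - by apply: is_derive_coord; apply: dgE; exact: inab'.
  - apply: continuous_in_subspaceT s sab => s; rewrite inE/= in_itv/= => sab.
    exact/continuous_coord/cg/inab.
  - rewrite normrM (@ger0_norm _ (b - a)) ?subr_ge0 ?(ltW ab)//.
    rewrite ler_wpM2r ?subr_ge0 ?(ltW ab)//.
    exact/(le_trans (coord_le_norm _ _))/dgc/inab'.
have t0d : `|t0 - t0| <= d by rewrite subrr normr0.
have [tt0|t0t] := leP t t0.
- rewrite distrC (le_trans (mv _ _ tt0 td t0d))// ler_wpM2l//.
  by move: td; rewrite ler_norml => /andP[? _]; lra.
- rewrite (le_trans (mv _ _ (ltW t0t) t0d td))// ler_wpM2l//.
  by move: td; rewrite ler_norml => /andP[_ ?]; lra.
Qed.

(** * Functions with continuous partial derivatives *)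

(** No order of [a] and [b] is assumed, and the intermediate point comes as a convex combination,
    ready for convexity estimates. *)
Lemma mvt_line (R : realType) (f df : R -> R) (a b : R) :
  (forall s : R, is_derive s 1 f (df s)) ->
  exists2 s, (exists2 l, 0 <= l <= 1 & s = a + l * (b - a)) &
             f b - f a = df s * (b - a).
Proof.
move=> fE; have fc s : {for s, continuous f} := is_derive_continuous (fE s).
have mv x y : x < y -> exists2 c, x < c < y & f y - f x = df c * (y - x).
  move=> xy; have [s|c cxy ->] := @MVT R f df x y xy (fun s _ => fE s).
    by apply: continuous_in_subspaceT s => s _; exact: fc.
  by exists c => //; move: cxy; rewrite in_itv.
have par (x y c : R) : x < c < y -> 0 <= (c - x) / (y - x) <= 1.
  move=> /andP[? ?]; by rewrite divr_ge0 ?ler_pdivrMr; lra.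
case: (ltgtP a b) => [ab|ba|<-].
- have [c cab ->] := mv _ _ ab; exists c => //.
  by exists ((c - a) / (b - a)); [exact: par|field; lra].
- have [c cab /(congr1 -%R)] := mv _ _ ba; rewrite opprB -mulrN opprB => ->.
  exists c => //; exists (1 - (c - b) / (a - b)); last by field; lra.
  by have := par _ _ _ cab; lra.
- by exists a; rewrite ?subrr ?mulr0//; exists 0; rewrite ?mulr0 ?addr0 ?lexx ?ler01.
Qed.

Lemma is_derive_line (R : realType) (n : nat) (h : 'rV[R]_n -> R) (i : 'I_n)
    (z : 'rV[R]_n) (s : R) :
  derivable h (z + s *: delta_mx 0 i) (delta_mx 0 i) ->
  is_derive s 1 (fun r => h (z + r *: delta_mx 0 i))
    (partial i h (z + s *: delta_mx 0 i)).
Proof.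
move=> dh; apply/is_derive_cvg; rewrite /partial /derive.
rewrite (_ : (fun r => _) = fun r : R => r^-1 *:
    ((h \o shift (z + s *: delta_mx 0 i)) (r *: delta_mx 0 i) -
     h (z + s *: delta_mx 0 i))) //.
by apply/funext => r /=; rewrite scalerDl addrCA addrA.
Qed.

(* Change the coordinates of x into those of y one at a time and apply the mean
   value theorem to each step; the intermediate points have every coordinate
   between those of x and y. *)
Lemma mvt_partial (R : realType) (n : nat) (h : 'rV[R]_n -> R) :
  (forall i x, derivable h x (delta_mx 0 i)) ->
  forall x y : 'rV[R]_n, exists c : 'I_n -> 'rV[R]_n,
    (forall a r, `|x - a| <= r -> `|y - a| <= r -> forall i, `|c i - a| <= r) /\
    h y - h x = \sum_i partial i h (c i) * (y 0 i - x 0 i).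
Proof.
move=> dh x y.
(* The path from [w 0 = x] to [w n = y]; the increments of [h] along it telescope. *)
pose w k : 'rV[R]_n := \row_(j < n) if (j < k)%N then y 0 j else x 0 j.
have wS (i : 'I_n) : w i.+1 = w i + (y 0 i - x 0 i) *: delta_mx 0 i.
  apply/rowP => j; rewrite !mxE eqxx/= ltnS leq_eqVlt.
  have [->|ij] := eqVneq j i; first by rewrite eqxx ltnn mulr1; ring.
  by rewrite (_ : (val j == val i) = false) ?mulr0 ?addr0//; apply/negbTE.
have step (i : 'I_n) : exists l, 0 <= l <= 1 /\
    h (w i.+1) - h (w i) =
    partial i h (w i + (l * (y 0 i - x 0 i)) *: delta_mx 0 i) * (y 0 i - x 0 i).
  have [s [l l01 ->]] := @mvt_line R (fun r => h (w i + r *: delta_mx 0 i)) _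
    0 (y 0 i - x 0 i) (fun s => is_derive_line (dh i _)).
  by rewrite scale0r addr0 subr0 add0r -wS => ->; exists l.
have [l lP] := choice step.
exists (fun i : 'I_n => w i + (l i * (y 0 i - x 0 i)) *: delta_mx 0 i).
split; last first.
  have -> : h y - h x = h (w n) - h (w 0%N).
    by congr (h _ - h _); apply/rowP => j; rewrite mxE// ltn_ord.
  rewrite -(telescope_sumr (fun k => h (w k)))// big_mkord.
  by apply: eq_bigr => i _; have [_] := lP i.
move=> a r xa ya i.
have r0 : 0 <= r := le_trans (normr_ge0 _) xa.
have {}xa j : `|x 0 j - a 0 j| <= r.
  by have := le_trans (coord_le_norm _ j) xa; rewrite !mxE.
have {}ya j : `|y 0 j - a 0 j| <= r.
  by have := le_trans (coord_le_norm _ j) ya; rewrite !mxE.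
apply: norm_le_coord => // j; rewrite !mxE eqxx/=.
have [->|ij] := eqVneq j i; last first.
  by rewrite mulr0 addr0; case: ifP.
rewrite ltnn mulr1; have [/andP[l0 l1] _] := lP i.
(* Coordinate [i] of [c i] is a convex combination of those of [x] and [y], hence as close to
   [a 0 i] as they are. *)
have -> : x 0 i + l i * (y 0 i - x 0 i) - a 0 i =
  (1 - l i) * (x 0 i - a 0 i) + l i * (y 0 i - a 0 i) by ring.
rewrite (le_trans (ler_normD _ _))// !normrM (ger0_norm l0) ger0_norm ?subr_ge0//.
rewrite (_ : r = (1 - l i) * r + l i * r); last by ring.
by rewrite lerD// ler_wpM2l// subr_ge0.
Qed.

Definition locally_lipschitz (R : realType) (n p : nat)
    (f : 'rV[R]_n -> 'rV[R]_p) :=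
  forall x : 'rV[R]_n, exists r L : R, [/\ 0 < r, 0 <= L &
    forall y z : 'rV[R]_n, `|y - x| <= r -> `|z - x| <= r ->
      `|f y - f z| <= L * `|y - z|].

Lemma class_C1_continuous_partial (R : realType) (n : nat) (h : 'rV[R]_n -> R) :
  class_C 1 h -> forall i, continuous (partial i h).
Proof. by move=> [_ Ch] i; have [_ []] := Ch i. Qed.

Lemma class_C1_derivable (R : realType) (n : nat) (h : 'rV[R]_n -> R) :
  class_C 1 h -> forall i x, derivable h x (delta_mx 0 i).
Proof. by move=> [_ Ch] i x; have [] := Ch i. Qed.

(** Near [x] each partial derivative exceeds its size at [x] by at most 1, and [mvt_partial] turns
    these bounds into a Lipschitz constant. It is stated for all small [r] so that finitely many
    functions can share one radius. *)
Lemma class_C1_lipschitz (R : realType) (n : nat) (h : 'rV[R]_n -> R) :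
  class_C 1 h -> forall x : 'rV[R]_n, exists2 L, 0 <= L &
  \forall r \near 0^'+, forall y z : 'rV[R]_n, `|y - x| <= r -> `|z - x| <= r ->
    `|h y - h z| <= L * `|y - z|.
Proof.
move=> Ch x; pose L := \sum_i (`|partial i h x| + 1).
exists L; first by apply: sumr_ge0 => i _; rewrite addr_ge0.
have nx : \forall y \near x, forall i, `|partial i h y| <= `|partial i h x| + 1.
  apply: (@filter_forall _ _
    (fun i y => `|partial i h y| <= `|partial i h x| + 1) (nbhs x) _) => i.
  have /cvgrPdist_le/(_ _ ltr01) := @class_C1_continuous_partial _ _ _ Ch i x.
  apply: filterS => y xy.
  by rewrite -lerBlDl (le_trans (lerB_dist _ _))// distrC.
have /nbhs_ballP[e /= e0 eP] := nx.
near=> r => y z yr zr; rewrite distrC (distrC y).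
have [c [cP ->]] := mvt_partial (class_C1_derivable Ch) y z.
rewrite (le_trans (ler_norm_sum _ _ _))// mulr_suml ler_sum// => i _.
rewrite normrM ler_pM//; last by have := coord_le_norm (z - y) i; rewrite !mxE.
apply: eP; rewrite -ball_normE/= distrC (le_lt_trans (cP _ _ yr zr i))//.
Unshelve. all: end_near. Qed.

(** By [mvt_partial] the difference quotient is a sum of partial derivatives at points [c s i] times
    quotients of coordinates of [g]. The points are no farther from [g t] than [g (s + t)] is, so
    continuity of the partials gives the limit. *)
Lemma is_derive_comp_C1 (R : realType) (n : nat) (h : 'rV[R]_n -> R)
    (g : R -> 'rV[R]_n) (t : R) (v : 'rV[R]_n) :
  class_C 1 h -> is_derive t 1 g v ->
  is_derive t 1 (h \o g) (\sum_i partial i h (g t) * v 0 i).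
Proof.
move=> Ch dg.
have [c cP] := choice (fun s => mvt_partial (class_C1_derivable Ch) (g t) (g (s + t))).
apply/is_derive_cvg.
rewrite (_ : (fun s => _) = fun s : R => \sum_i
    partial i h (c s i) * (s^-1 *: (g (s + t) 0 i - g t 0 i))); last first.
  apply/funext => s /=; have [_ ->] := cP s.
  by rewrite scaler_sumr; apply: eq_bigr => i _; rewrite scalerAr.
apply: cvg_big => [|i _]; first exact: add_continuous.
apply: cvgM; last first.
  exact: (is_derive_cvg (fun s => g s 0 i) t _).2 (is_derive_coord i dg).
apply: (@cvg_comp _ _ _ (fun s => c s i) (partial i h) _ (nbhs (g t))); last first.
  exact: class_C1_continuous_partial.
have gc0 : g (s + t) @[s --> 0] --> g t.
  apply: (@cvg_comp _ _ _ (fun s : R => s + t) g _ (nbhs t)).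
    by rewrite -{2}(add0r t); apply: cvgD; [exact: cvg_id|exact: cvg_cst].
  exact: is_derive_continuous dg.
have gc : g (s + t) @[s --> 0^'] --> g t.
  by apply: cvg_trans gc0; apply: cvg_app; exact: nbhs_dnbhs.
apply/cvgrPdist_le => e e0; have /cvgrPdist_le/(_ _ e0) := gc.
apply: filterS => s gs; have [cs _] := cP s.
by rewrite distrC cs// ?subrr ?normr0 ?(ltW e0)// distrC.
Qed.

(** * Primitives and geometric limits *)

Lemma half_pow_lt (R : realType) (c e : R) : 0 < e -> exists k, c / 2 ^+ k < e.
Proof.
move=> e0; exists (Num.truncn (c / e)).+1; set k := _.+1.
rewrite ltr_pdivrMr ?exprn_gt0// mulrC -ltr_pdivrMr//.
rewrite (lt_trans (truncnS_gt _))// -/k -natrX ltr_nat.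
exact: ltn_expl.
Qed.

Lemma le0_half_pow (R : realType) (a c : R) :
  (forall k, a <= c / 2 ^+ k) -> a <= 0.
Proof.
move=> ac; rewrite leNgt; apply/negP => /(half_pow_lt c)[k].
by rewrite ltNge ac.
Qed.

Lemma geometric_limit (R : realType) (u : nat -> R) (c : R) :
  (forall k, `|u k.+1 - u k| <= c / 2 ^+ k) ->
  exists l, forall k, `|l - u k| <= 2 * c / 2 ^+ k.
Proof.
move=> uc.
(* Keeping the exact geometric remainder in the bound makes the induction on [m] close. *)
have tele k m : `|u (k + m)%N - u k| <= 2 * c / 2 ^+ k - 2 * c / 2 ^+ (k + m).
  elim: m => [|m IH]; first by rewrite addn0 !subrr normr0.
  rewrite addnS -(subrKA (u (k + m)%N)) (le_trans (ler_normD _ _))//.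
  rewrite (le_trans (lerD (uc _) IH))// exprS.
  have p : 2 ^+ (k + m) != 0 :> R by rewrite expf_neq0.
  by rewrite le_eqVlt; apply/orP; left; apply/eqP; field; rewrite p expf_neq0.
have c0 : 0 <= c by have := le_trans (normr_ge0 _) (uc 0%N); rewrite expr0 divr1.
have ub k m : (k <= m)%N -> `|u m - u k| <= 2 * c / 2 ^+ k.
  move=> /subnKC <-; rewrite (le_trans (tele _ _))// gerBl.
  by rewrite divr_ge0 ?mulr_ge0 ?exprn_ge0.
have /cvg_ex[l ul] : cvg (u @ \oo).
  apply/cauchy_cvgP/cauchy_exP => e e0; have [k ke] := half_pow_lt (2 * c) e0.
  exists (u k); exists k => // m /= km; rewrite -ball_normE/= distrC.
  exact: le_lt_trans (ub _ _ km) ke.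
exists l => k; apply/ler_addgt0Pr => e e0.
have /cvgrPdist_le/(_ _ e0)[m _ mP] := ul.
have := mP (maxn k m) (leq_maxr _ _) => /= lu.
rewrite -(subrKA (u (maxn k m))) (le_trans (ler_normD _ _))// addrC lerD//.
by rewrite ub// leq_maxl.
Qed.

Lemma geometric_limit_row (R : realType) (n : nat) (u : nat -> 'rV[R]_n)
    (c : R) :
  (forall k, `|u k.+1 - u k| <= c / 2 ^+ k) ->
  exists l, forall k, `|l - u k| <= 2 * c / 2 ^+ k.
Proof.
move=> uc.
have c0 : 0 <= c by have := le_trans (normr_ge0 _) (uc 0%N); rewrite expr0 divr1.
have ui (i : 'I_n) k : `|u k.+1 0 i - u k 0 i| <= c / 2 ^+ k.
  by have := le_trans (coord_le_norm _ i) (uc k); rewrite !mxE.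
have [l lP] := choice (fun i => geometric_limit (ui i)).
exists (\row_i l i) => k; apply: norm_le_coord => [|i]; last by rewrite !mxE.
by rewrite divr_ge0 ?mulr_ge0 ?exprn_ge0.
Qed.

(** For [0 <= r], the projection of the line onto [a - r, a + r]. It serves both to stop time at
    [-h] and [h] and, coordinatewise, to project onto a cube. *)
Definition clamp (R : realType) (a r t : R) := Num.max (a - r) (Num.min (a + r) t).

Lemma clamp_dist (R : realType) (a r t : R) : 0 <= r -> `|clamp a r t - a| <= r.
Proof.
move=> r0; rewrite /clamp ler_norml; apply/andP.
by case: (leP (a + r) t) => ?; case: (leP (a - r)) => ?; split; lra.
Qed.

Lemma clamp_id (R : realType) (a r t : R) : `|t - a| <= r -> clamp a r t = t.
Proof.
rewrite ler_norml => /andP[? ?]; rewrite /clamp min_r ?max_r//; lra.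
Qed.

Lemma clamp_lipschitz (R : realType) (a r s t : R) : 0 <= r ->
  `|clamp a r s - clamp a r t| <= `|s - t|.
Proof.
move=> r0; have L x y : x <= y -> `|clamp a r x - clamp a r y| <= y - x.
  move=> xy; rewrite ler_norml /clamp; apply/andP.
  by case: (leP (a + r) x) => ?; case: (leP (a + r) y) => ?;
    do ?[case: (leP (a - r)) => ?]; split; lra.
have [st|/ltW ts] := leP s t.
- by rewrite (distrC s) (@ger0_norm _ (t - s)) ?subr_ge0 ?L.
- by rewrite distrC (@ger0_norm _ (s - t)) ?subr_ge0 ?L.
Qed.

Lemma clamp_continuous (R : realType) (a r : R) : 0 <= r ->
  continuous (clamp a r).
Proof.
move=> r0 t; apply/cvgrPdist_le => e e0; near=> s.
rewrite (le_trans (clamp_lipschitz _ _ _ _))//.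
Unshelve. all: by end_near. Qed.

Lemma continuous_row (R : realType) (T : topologicalType) (n : nat)
    (g : T -> 'rV[R]_n) (t : T) :
  (forall i, {for t, continuous (fun s => g s 0 i)}) -> {for t, continuous g}.
Proof.
move=> gi; apply/cvgrPdist_le => e e0.
have : \forall s \near t, forall i, `|g t 0 i - g s 0 i| <= e.
  by apply: filter_forall => i; have /cvgrPdist_le := gi i; apply.
apply: filterS => s gs; apply: norm_le_coord (ltW e0) _ => i.
by rewrite !mxE.
Qed.

Lemma primitive (R : realType) (f : R -> R) (h : R) : 0 < h -> continuous f ->
  exists F : R -> R, [/\ F 0 = 0, continuous F,
    forall t : R, `|t| < h -> is_derive t 1 F (f t) &
    forall t, F (clamp 0 h t) = F t].
Proof.
move=> h0 cf; pose mu := @lebesgue_measure R.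
(* Integrating from [- (2 * h)] puts [-h, h] strictly inside the domain of integration, so [G] has a
   two-sided derivative at [-h] and [h] as well. *)
pose G (t : R) := (\int[mu]_(s in `[(- (2 * h))%R, t]) f s)%R.
have dG (t : R) : `|t| <= h -> is_derive t 1 G (f t).
  rewrite ler_norml => /andP[t1 t2].
  have int : mu.-integrable `[- (2 * h), 2 * h] (EFin \o f).
    apply: continuous_compact_integrable; first exact: segment_compact.
    exact: continuous_subspaceT.
  have [|||dGt Gt] := @continuous_FTC1_closed R f (- (2 * h)) t (2 * h) _ int.
  - lra.
  - lra.
  - exact: cf.
  - by apply: DeriveDef => //; rewrite -derive1E.
pose F t := G (clamp 0 h t) - G 0.
exists F; split.
- by rewrite /F clamp_id ?subrr// normr0 ltW.
- move=> t; apply: cvgB; last exact: cvg_cst.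
  apply: (@continuous_comp _ _ _ (clamp 0 h) G); first exact: clamp_continuous (ltW h0) _.
  apply: is_derive_continuous (dG _ _).
  by have := clamp_dist 0 t (ltW h0); rewrite subr0.
- move=> t th; apply: (@near_eq_is_derive _ _ _ (fun s => G s - G 0)).
  + near=> s; rewrite /F clamp_id// subr0 ltW//.
    near: s; apply: (cvgr_lt `|t|) => //.
    exact: (@norm_continuous _ R).
  + rewrite -[f t]subr0; apply: is_deriveB.
    exact/dG/ltW.
- by move=> t; rewrite /F (clamp_id (clamp_dist _ _ (ltW h0))).
Unshelve. all: by end_near. Qed.

(** * The Picard-Lindelof theorem *)

(** With [f] composed with a curve as integrand, this is the Picard integral operator with initial
    value [x]. *)
Lemma primitive_row (R : realType) (n : nat) (f : R -> 'rV[R]_n) (h : R)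
    (x : 'rV[R]_n) : 0 < h -> continuous f ->
  exists F : R -> 'rV[R]_n, [/\ F 0 = x, continuous F,
    forall t : R, `|t| < h -> is_derive t 1 F (f t) &
    forall t, F (clamp 0 h t) = F t].
Proof.
move=> h0 cf.
have [F FP] := choice (fun i => primitive h0 (fun t => @continuous_coord _ _ _ f t i (cf t))).
exists (fun t => \row_i (x 0 i + F i t)); split.
- by apply/rowP => i; rewrite mxE; have [-> _ _ _] := FP i; rewrite addr0.
- move=> t; apply: continuous_row => i; have [_ cF _ _] := FP i.
  rewrite (_ : (fun s => _) = fun s => x 0 i + F i s); last first.
    by apply/funext => s; rewrite mxE.
  by apply: cvgD; [exact: cvg_cst|exact: cF].
- move=> t th; apply: is_derive_row => i; have [_ _ dF _] := FP i.
  rewrite (_ : (fun s => _) = fun s => x 0 i + F i s); last first.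
    by apply/funext => s; rewrite mxE.
  by rewrite -[f t 0 i]add0r; apply: is_deriveD; exact: dF.
- by move=> t; apply/rowP => i; rewrite !mxE; have [_ _ _ ->] := FP i.
Qed.

(* Every iterate and the limit are constant outside ]-h, h[, so that all
   estimates hold uniformly on R. *)
Lemma picard (R : realType) (n : nat) (f : 'rV[R]_n -> 'rV[R]_n) (L h : R)
    (x : 'rV[R]_n) :
  0 < h -> 0 <= L -> L * h <= 2^-1 ->
  (forall y z, `|f y - f z| <= L * `|y - z|) ->
  exists g : R -> 'rV[R]_n, g 0 = x /\
    forall t : R, `|t| < h -> is_derive t 1 g (f (g t)).
Proof.
move=> h0 L0 Lh fL.
have cf : continuous f.
  move=> y; apply/(@cvgrPdist_le _ _ _ (nbhs y) (nbhs_filter y)) => e e0.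
  have d0 : 0 < e / (L + 1) by rewrite divr_gt0//; lra.
  apply: filterS (nbhsx_ballx y _ d0) => z; rewrite -ball_normE/= => /ltW yz.
  rewrite (le_trans (fL _ _))// (@le_trans _ _ ((L + 1) * (e / (L + 1))))//.
    by rewrite ler_pM//; lra.
  by rewrite mulrC divfK//; lra.
(* Choice needs a total operator, so its specification is conditional on continuity; a discontinuous
   [g] gets itself as a dummy value. *)
have stepP (g : R -> 'rV[R]_n) : exists F : R -> 'rV[R]_n, continuous g ->
    [/\ F 0 = x, continuous F,
      forall t : R, `|t| < h -> is_derive t 1 F (f (g t)) &
      forall t, F (clamp 0 h t) = F t].
  have [cg|] := pselect (continuous g); last by exists g.
  have cfg : continuous (f \o g).
    by move=> t; apply: continuous_comp; [exact: cg|exact: cf].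
  by have [F] := primitive_row x h0 cfg; exists F.
have [P PP] := choice stepP.
(* Evaluating at [clamp 0 h t] extends the estimate from [-h, h] to all times. *)
have Pdist (g1 g2 : R -> 'rV[R]_n) (c : R) :
    continuous g1 -> continuous g2 -> 0 <= c ->
    (forall t, `|f (g1 t) - f (g2 t)| <= c) ->
    forall t, `|P g1 t - P g2 t| <= c * h.
  move=> /PP[z1 c1 d1 e1] /PP[z2 c2 d2 e2] c0 gc t.
  have := @increment_bound _ _ (P g1 - P g2) (fun t => f (g1 t) - f (g2 t)) 0 h
    c c0 _ _ _ (clamp 0 h t) (clamp_dist 0 t (ltW h0)).
  rewrite !fctE e1 e2 z1 z2 subrr subr0; apply.
  - by move=> s _; apply: cvgB; [exact: c1|exact: c2].
  - by move=> s; rewrite subr0 => sh; apply: is_deriveB; [exact: d1|exact: d2].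
  - by move=> s _; exact: gc.
pose g k := iter k P (cst x).
have cg k : continuous (g k).
  by elim: k => [|k /PP[]//]; move=> t; exact: cvg_cst.
pose c := `|f x| * h.
have c0 : 0 <= c by rewrite mulr_ge0// ltW.
(* The first step moves by at most [c], and [L * h <= 2^-1] halves each later one. *)
have gS k t : `|g k.+1 t - g k t| <= c / 2 ^+ k.
  elim: k t => [|k IH] t.
    have [z0 cP dP eP] := PP _ (cg 0%N).
    rewrite expr0 divr1 -[X in _ - X]z0 -[g 1%N t]/(P (g 0%N) t) -[P _ t]eP.
    apply: (@increment_bound _ _ _ (fun=> f x)) => //.
    - by move=> s _; exact: cP.
    - by move=> s; rewrite subr0; exact: dP.
    - exact: clamp_dist (ltW h0).
  apply: (le_trans (Pdist (g k.+1) (g k) (L * (c / 2 ^+ k)) (cg _) (cg _) _ _ t)).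
  - by rewrite mulr_ge0// divr_ge0// exprn_ge0.
  - by move=> s; rewrite (le_trans (fL _ _))// ler_wpM2l.
  - rewrite mulrAC exprS invfM (mulrCA c) ler_wpM2r//.
    by rewrite divr_ge0// exprn_ge0.
have [l lP] := choice (fun t => @geometric_limit_row _ _ (g ^~ t) c (gS ^~ t)).
(* A uniform limit of continuous curves is continuous, by the usual three thirds of [e]. *)
have cl : continuous l.
  move=> t; apply/cvgrPdist_le => e e0.
  have [k ke] := half_pow_lt (2 * c) (divr_gt0 e0 (ltr0Sn R 2)).
  have /cvgrPdist_le/(_ _ (divr_gt0 e0 (ltr0Sn R 2))) := cg k t.
  apply: (@filterS _ (nbhs t)) => s gs.
  have := ler_distD (g k t) (l t) (l s); have := ler_distD (g k s) (g k t) (l s).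
  have := lP t k; have := lP s k; rewrite (distrC (l s)).
  by move: gs ke; lra.
have [z0 _ dP _] := PP _ cl.
(* Both [P l] and [l] lie within half of [2 * c / 2 ^+ k] of [g k.+1], for every [k]. *)
have Pl : P l = l.
  apply/funext => t; apply/eqP; rewrite -subr_eq0 -normr_le0.
  apply: (@le0_half_pow _ _ (2 * c)) => k.
  rewrite (le_trans (ler_distD (g k.+1 t) _ _))//.
  have p : 2 ^+ k != 0 :> R by rewrite expf_neq0.
  rewrite (_ : 2 * c / 2 ^+ k = L * (2 * c / 2 ^+ k) * h +
    (2^-1 - L * h + 2^-1) * (2 * c / 2 ^+ k)); last by field.
  have ck0 : 0 <= 2 * c / 2 ^+ k := le_trans (normr_ge0 _) (lP t k).
  apply: lerD.
    apply: Pdist => //.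
      exact: mulr_ge0 L0 ck0.
    by move=> s; rewrite (le_trans (fL _ _))// ler_wpM2l.
  rewrite distrC (le_trans (lP _ _))//.
  rewrite exprS (_ : 2 * c / (2 * 2 ^+ k) = 2^-1 * (2 * c / 2 ^+ k)); last by field.
  by rewrite ler_wpM2r//; lra.
by exists l; rewrite -{1}Pl; split=> // t th; rewrite -{1}Pl; exact: dP.
Qed.

(* Precomposing f with the projection onto a cube makes it globally Lipschitz
   and bounded; for short times the solution stays inside the cube. *)
Lemma ode_local_existence (R : realType) (n : nat) (f : 'rV[R]_n -> 'rV[R]_n)
    (U : set 'rV[R]_n) (x : 'rV[R]_n) :
  locally_lipschitz f -> open U -> U x ->
  exists2 h : R, 0 < h & exists g : R -> 'rV[R]_n, g 0 = x /\
    forall t : R, `|t| < h -> U (g t) /\ is_derive t 1 g (f (g t)).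
Proof.
move=> fl oU Ux; have [r0 [L [r00 L0 fL]]] := fl x.
have /nbhs_ballP[r1 /= r10 r1U] : nbhs x U by exact: open_nbhs_nbhs.
(* The closed cube of radius [r] lies in the region of the Lipschitz estimate and, by the factor
   1/2, inside the open ball contained in [U]. *)
pose r := Num.min r0 (r1 / 2).
have rgt0 : 0 < r by rewrite lt_min r00 divr_gt0.
have rr0 : r <= r0 by rewrite ge_min lexx.
have rr1 : r < r1 by rewrite gt_min; apply/orP; right; lra.
pose p (y : 'rV[R]_n) : 'rV[R]_n := \row_i clamp (x 0 i) r (y 0 i).
have px y : `|p y - x| <= r.
  by apply: norm_le_coord (ltW rgt0) _ => i; rewrite !mxE clamp_dist// ltW.
have plip y z : `|p y - p z| <= `|y - z|.
  apply: norm_le_coord => // i; rewrite !mxE.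
  apply: (le_trans (clamp_lipschitz _ _ _ (ltW rgt0))).
  by have := coord_le_norm (y - z) i; rewrite !mxE.
have pid y : `|y - x| <= r -> p y = y.
  move=> yr; apply/rowP => i; rewrite mxE clamp_id//.
  by have := le_trans (coord_le_norm _ i) yr; rewrite !mxE.
pose M := `|f x| + L * r.
have M0 : 0 <= M by rewrite addr_ge0// mulr_ge0// ltW.
have fM y : `|f (p y)| <= M.
  rewrite -(subrK (f x) (f (p y))) (le_trans (ler_normD _ _))// addrC lerD2l.
  apply: le_trans (fL _ _ _ _) _.
  - exact: le_trans (px _) rr0.
  - by rewrite subrr normr0 ltW.
  - by rewrite ler_wpM2l.
(* The first bound makes the Picard operator contract by 1/2; the second keeps a curve of speed at
   most [M] in the cube. Adding 1 avoids dividing by zero. *)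
pose h := Num.min (2 * (L + 1))^-1 (r / (M + 1)).
have h0 : 0 < h by rewrite lt_min invr_gt0 divr_gt0//; lra.
have Lh : L * h <= 2^-1.
  apply: (@le_trans _ _ ((L + 1) * (2 * (L + 1))^-1)).
    by rewrite ler_pM// ?(ltW h0)// ?ge_min ?lexx//; lra.
  by rewrite invfM mulrCA mulfV ?mulr1//; lra.
have Mh : M * h <= r.
  apply: (@le_trans _ _ ((M + 1) * (r / (M + 1)))).
    by rewrite ler_pM// ?(ltW h0)// ?ge_min ?lexx ?orbT//; lra.
  by rewrite mulrC divfK//; lra.
have [g [gx dg]] : exists g : R -> 'rV[R]_n, g 0 = x /\
    forall t : R, `|t| < h -> is_derive t 1 g (f (p (g t))).
  apply: (@picard _ _ (f \o p) L) => // y z /=.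
  rewrite (le_trans (fL _ _ _ _)) ?ler_wpM2l//; exact: le_trans (px _) rr0.
exists h => //; exists g; split=> // t th.
(* Inside the cube [p] is the identity, so [g] solves the original equation. *)
have gr : `|g t - x| <= r.
  rewrite -gx (le_trans _ Mh)//.
  apply: (le_trans (@increment_bound _ _ g (f \o p \o g) 0 `|t| M M0 _ _ _ t _)).
  - by move=> s; rewrite subr0 => st; apply/is_derive_continuous/dg/(le_lt_trans st).
  - by move=> s; rewrite subr0 => st; apply/dg/(lt_trans st).
  - by move=> s _; exact: fM.
  - by rewrite subr0.
  - by rewrite ler_wpM2l// ltW.
split; last by rewrite -(pid _ gr); exact: dg.
by apply: r1U; rewrite -ball_normE/= distrC (le_lt_trans gr).
Qed.

(** On a short interval around [t0] the solutions differ by at most [2 * r], and with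
    [L * d <= 2^-1] each pass through the Lipschitz estimate halves this bound, forcing the
    difference to be zero. *)
Lemma ode_unique_near (R : realType) (n : nat) (f : 'rV[R]_n -> 'rV[R]_n)
    (g1 g2 : R -> 'rV[R]_n) (t0 : R) :
  locally_lipschitz f -> g1 t0 = g2 t0 ->
  (\forall t \near t0, is_derive (t : R) 1 g1 (f (g1 t)) /\
                       is_derive (t : R) 1 g2 (f (g2 t))) ->
  \forall t \near t0, g1 t = g2 t.
Proof.
move=> fl g12 dg; have [r [L [r0 L0 fL]]] := fl (g1 t0).
have [d1 d2] := nbhs_singleton dg.
have /cvgrPdist_le/(_ _ r0) n1 := is_derive_continuous d1.
have /cvgrPdist_le/(_ _ r0) n2 := is_derive_continuous d2.
have /nbhs_ballP[e /= e0 eP] :=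
  @filterI _ _ (nbhs_filter t0) _ _ dg (@filterI _ _ (nbhs_filter t0) _ _ n1 n2).
pose d := Num.min (e / 2) (2 * (L + 1))^-1.
have d0 : 0 < d by rewrite lt_min divr_gt0// invr_gt0; lra.
have de : d < e by rewrite gt_min; apply/orP; left; lra.
have Ld : (L * d : R) <= 2^-1.
  apply: (@le_trans _ R ((L + 1) * (2 * (L + 1))^-1)).
    by rewrite ler_pM// ?(ltW d0)// ?ge_min ?lexx ?orbT//; lra.
  by rewrite invfM mulrCA mulfV ?mulr1// lt0r_neq0//; lra.
have {}eP (t : R) : `|t - t0| <= d -> [/\ is_derive t 1 g1 (f (g1 t)),
    is_derive t 1 g2 (f (g2 t)), `|g1 t - g1 t0| <= r & `|g2 t - g1 t0| <= r].
  move=> td; have [] := eP t; first by rewrite -ball_normE/= distrC (le_lt_trans td).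
  by move=> [? ?] [? ?]; split=> //; rewrite distrC// g12.
have decay k t : `|t - t0| <= d -> `|g1 t - g2 t| <= 2 * r / 2 ^+ k.
  elim: k t => [|k IH] t td.
    rewrite expr0 divr1; have [_ _ ? ?] := eP _ td.
    by rewrite (le_trans (ler_distD (g1 t0) _ _))// (distrC (g1 t0)); lra.
  have c0 : 0 <= 2 * r / 2 ^+ k := le_trans (normr_ge0 _) (IH t td).
  have -> : g1 t - g2 t = (g1 - g2) t - (g1 - g2) t0.
    by rewrite !fctE g12 subrr subr0.
  have p : 2 ^+ k != 0 :> R by rewrite expf_neq0.
  apply: (@le_trans _ _ (L * (2 * r / 2 ^+ k) * d)); last first.
    rewrite mulrAC exprS (_ : 2 * r / (2 * 2 ^+ k) = 2^-1 * (2 * r / 2 ^+ k)).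
      by rewrite ler_wpM2r.
    by field.
  have dg12 (s : R) : `|s - t0| <= d ->
      is_derive s 1 (g1 - g2) (f (g1 s) - f (g2 s)).
    by move=> /eP[? ? _ _]; exact: is_deriveB.
  apply: (@increment_bound _ _ _ (fun s => f (g1 s) - f (g2 s))) => //.
  - exact: mulr_ge0.
  - by move=> s /dg12; exact: is_derive_continuous.
  - by move=> s /ltW /dg12.
  - move=> s /ltW sd; have [_ _ ? ?] := eP _ sd.
    by rewrite (le_trans (fL _ _ _ _))// ler_wpM2l// IH.
apply/nbhs_ballP; exists d => //= t; rewrite -ball_normE/= distrC => /ltW td.
apply/eqP; rewrite -subr_eq0 -normr_le0.
by apply: (@le0_half_pow _ _ (2 * r)) => k; exact: decay.
Qed.

(** Agreement is an open condition by local uniqueness and disagreement is open by continuity;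
    connectedness of the interval leaves only agreement. *)
Lemma ode_unique (R : realType) (n : nat) (f : 'rV[R]_n -> 'rV[R]_n)
    (g1 g2 : R -> 'rV[R]_n) (I : set R) (t0 : R) :
  locally_lipschitz f -> open I -> is_interval I -> I t0 -> g1 t0 = g2 t0 ->
  (forall t : R, I t -> is_derive t 1 g1 (f (g1 t))) ->
  (forall t : R, I t -> is_derive t 1 g2 (f (g2 t))) ->
  forall t, I t -> g1 t = g2 t.
Proof.
move=> fl oI iI It0 g12 d1 d2.
pose A := [set t | I t /\ g1 t = g2 t].
have oA : open A.
  rewrite openE => t [It gt]; have nI : nbhs t I by exact: open_nbhs_nbhs.
  have ng : \forall s \near t, g1 s = g2 s.
    by apply: ode_unique_near fl gt _; apply: filterS nI => s Is; split; auto.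
  exact: filterI nI ng.
pose B := [set t | I t /\ g1 t != g2 t].
have oB : open B.
  rewrite openE => t [It gt]; have nI : nbhs t I by exact: open_nbhs_nbhs.
  have cB : {for t, continuous (g1 - g2)}.
    by apply: cvgB; [exact: is_derive_continuous (d1 _ It)|
                     exact: is_derive_continuous (d2 _ It)].
  have ng : \forall s \near t, g1 s != g2 s.
    have gt0 : 0 < `|(g1 - g2) t| by rewrite normr_gt0 !fctE subr_eq0.
    have /cvgrPdist_lt/(_ _ gt0) := cB; apply: filterS => s.
    by apply: contraTneq => gs; rewrite !fctE gs subrr subr0 ltxx.
  exact: filterI nI ng.
have AI : A = I.
  apply: ((connected_intervalP I).2 iI).
  - by exists t0.
  - by exists A => //; apply/seteqP; split=> t [].
  - exists (~` B); first exact: open_closedC.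
    apply/seteqP; split=> t [It gt]; split=> //.
      by move=> [_ /eqP].
    by apply: contrapT => /eqP gt'; exact: gt.
by move=> t; rewrite -AI => -[].
Qed.

(* The domain J is the union of the domains of all solutions, which are glued
   by uniqueness. *)
Lemma ode_maximal_solution (R : realType) (n : nat) (f : 'rV[R]_n -> 'rV[R]_n)
    (U : set 'rV[R]_n) (x : 'rV[R]_n) :
  locally_lipschitz f -> open U -> U x ->
  let solution (I : set R) (g : R -> 'rV[R]_n) :=
    [/\ open I, is_interval I, I 0, g 0 = x &
        forall t : R, I t -> U (g t) /\ is_derive t 1 g (f (g t))] in
  exists (J : set R) (g : R -> 'rV[R]_n),
    solution J g /\ forall I g', solution I g' -> I `<=` J.
Proof.
move=> fl oU Ux solution.
pose J := [set t | exists I g, solution I g /\ I t].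
have agree I1 g1 I2 g2 t : solution I1 g1 -> solution I2 g2 -> I1 t -> I2 t ->
    g1 t = g2 t.
  move=> [oI1 iI1 z1 gx1 d1] [oI2 iI2 z2 gx2 d2] I1t I2t.
  apply: (@ode_unique _ _ f g1 g2 (I1 `&` I2) 0) => //.
  - exact: openI.
  - move=> a b [a1 a2] [b1 b2] c cab.
    by split; [exact: iI1 a1 b1 _ cab|exact: iI2 a2 b2 _ cab].
  - by rewrite gx1.
  - by move=> s [/d1[]].
  - by move=> s [_ /d2[]].
(* By [agree] all solutions defined at [t] share one value there; outside [J] the value 0 is
   arbitrary. *)
have valP t : exists v, forall I g, solution I g -> I t -> g t = v.
  have [[I [g [Ig It]]]|nJ] := pselect (J t).
    by exists (g t) => I' g' Ig' I't; exact: agree Ig' Ig I't It.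
  by exists 0 => I g Ig It; exfalso; apply: nJ; exists I, g.
have [G GP] := choice valP.
have [I0 [g0 s0]] : exists I g, solution I g.
  have [h h0 [g [gx dg]]] := ode_local_existence fl oU Ux.
  exists [set t | `|t| < h], g; split=> //=; last by rewrite normr0.
    rewrite (_ : [set _ | _] = ball 0 h); first exact: ball_open.
    by rewrite -ball_normE; apply/seteqP; split=> t /=; rewrite sub0r normrN.
  move=> a b /=; rewrite !ltr_norml => /andP[? ?] /andP[? ?] c /andP[? ?] /=.
  by rewrite ltr_norml; apply/andP; split; lra.
have JS I g : solution I g -> I `<=` J by move=> Ig t It; exists I, g.
exists J, G; split=> //; split.
- rewrite openE => t [I [g [Ig It]]].
  have nI : nbhs t I by have [oI _ _ _ _] := Ig; exact: open_nbhs_nbhs.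
  exact: filterS (JS _ _ Ig) nI.
(* Every solution domain contains 0, so a point between [a] and [b] lies in [I1] or in [I2]
   according to its sign. *)
- move=> a b [I1 [g1 [s1 I1a]]] [I2 [g2 [s2 I2b]]] c /andP[ac cb].
  have [c0|/ltW c0] := leP 0 c.
    apply: (JS _ _ s2); have [_ iI2 z2 _ _] := s2.
    by apply: iI2 z2 I2b _ _; rewrite c0.
  apply: (JS _ _ s1); have [_ iI1 z1 _ _] := s1.
  by apply: iI1 I1a z1 _ _; rewrite c0 ac.
- by exists I0, g0; have [_ _ z0 _ _] := s0.
- by have [_ _ z0 x0 _] := s0; rewrite -(GP _ _ _ s0 z0).
- move=> t [I [g [Ig It]]]; have gG s : I s -> g s = G s by exact: GP Ig.
  have [oI _ _ _ dg] := Ig; have [Ugt dgt] := dg _ It.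
  rewrite -(gG _ It); split=> //; apply: near_eq_is_derive dgt.
  have nI : nbhs t I by exact: open_nbhs_nbhs.
  exact: filterS nI.
Qed.

(** * Gradient fields *)

Lemma is_derive_sum_fun (R : realType) (m : nat) (h : 'I_m -> R -> R)
    (dh : 'I_m -> R) (t : R) :
  (forall i, is_derive t 1 (h i) (dh i)) ->
  is_derive t 1 (fun s => \sum_i h i s) (\sum_i dh i).
Proof.
move=> dhP; rewrite (_ : (fun s => _) = \sum_i h i); first exact: is_derive_sum.
by apply/funext => s; rewrite fct_sumE.
Qed.

Lemma class_C2_C1 (R : realType) (n : nat) (h : 'rV[R]_n -> R) :
  class_C 2 h -> class_C 1 h.
Proof.
by move=> [ch Ch]; split=> // i; have [dh [cdh _]] := Ch i; split.
Qed.

Lemma class_C2_partial (R : realType) (n : nat) (h : 'rV[R]_n -> R) :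
  class_C 2 h -> forall i, class_C 1 (partial i h).
Proof. by move=> [_ Ch] i; have [] := Ch i. Qed.

Section Gradient.
Context {R : realType} {n N : nat}.
Variable u : 'rV[R]_n -> 'rV[R]_N.
Hypothesis u_C2 : forall a : 'I_N, class_C 2 (component u a).

(** Each entry of [Du u] is of class C^1, hence Lipschitz near [x], and the finitely many entries
    share a radius. *)
Lemma gradient_field_lipschitz (xi : 'rV[R]_N) :
  locally_lipschitz (fun y => xi *m Du u y).
Proof.
move=> x.
pose lip L (p : 'I_N * 'I_n) (r : R) := forall y z : 'rV[R]_n,
  `|y - x| <= r -> `|z - x| <= r ->
  `|Du u y p.1 p.2 - Du u z p.1 p.2| <= L * `|y - z|.
have lipP p : exists L : R, 0 <= L /\ \forall r \near 0^'+, lip L p r.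
  have [L L0 LP] := class_C1_lipschitz (class_C2_partial (u_C2 p.1) p.2) x.
  exists L; split=> //; apply: filterS LP => r rP y z yr zr.
  by rewrite !mxE; exact: rP.
have [L LP] := choice lipP.
have allP : \forall r \near 0^'+, forall p, lip (L p) p r.
  by apply: filter_forall => p; have [] := LP p.
near (0 : R)^'+ => r.
have rP : forall p, lip (L p) p r by near: r.
exists r, (\sum_a \sum_i `|xi 0 a| * L (a, i)); split=> //.
  apply: sumr_ge0 => a _; apply: sumr_ge0 => i _.
  by rewrite mulr_ge0//; have [] := LP (a, i).
move=> y z yr zr; rewrite -mulmxBr; apply: norm_le_coord => [|i].
  rewrite mulr_ge0//; apply: sumr_ge0 => a _; apply: sumr_ge0 => i _.
  by rewrite mulr_ge0//; have [] := LP (a, i).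
rewrite mxE (le_trans (ler_norm_sum _ _ _))// mulr_suml ler_sum// => a _.
rewrite normrM (bigD1 i)//= mulrDl ler_wpDr//.
  rewrite mulr_ge0//; apply: sumr_ge0 => j _.
  by rewrite mulr_ge0//; have [] := LP (a, j).
rewrite -mulrA ler_wpM2l//; have := rP (a, i) _ _ yr zr.
by rewrite !mxE.
Unshelve. all: by end_near. Qed.

(** Along an integral curve [v] is [xi *m Du u (g t)] itself, and the derivative is its squared
    Euclidean norm. *)
Lemma is_derive_dotv (xi : 'rV[R]_N) (g : R -> 'rV[R]_n) (t : R)
    (v : 'rV[R]_n) :
  is_derive t 1 g v ->
  is_derive t 1 (fun s => dotv xi (u (g s))) (dotv (xi *m Du u (g t)) v).
Proof.
move=> dg.
rewrite (_ : dotv _ v =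
    \sum_a xi 0 a *: \sum_i partial i (component u a) (g t) * v 0 i).
  apply: is_derive_sum_fun => a; apply: (@is_deriveZ _ _ _ (component u a \o g)).
  exact: is_derive_comp_C1 (class_C2_C1 (u_C2 a)) dg.
rewrite /dotv; under eq_bigr do rewrite mxE mulr_suml.
rewrite exchange_big/=; apply: eq_bigr => a _.
by rewrite scaler_sumr; apply: eq_bigr => i _; rewrite mxE -mulrA.
Qed.

(** Regrouping the sums exhibits linear dependence on [xi *m Du u y]; in particular the product
    vanishes with that vector. *)
Lemma dotv_laplacian (xi : 'rV[R]_N) (y : 'rV[R]_n) :
  dotv xi (tangential_infty_laplacian u y) =
  \sum_i (xi *m Du u y) 0 i * \sum_j \sum_b Du u y b j * D2u u y i j b.
Proof.
rewrite /dotv; under eq_bigr do rewrite mxE mulr_sumr.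
rewrite exchange_big/=; apply: eq_bigr => i _.
rewrite mxE mulr_suml; apply: eq_bigr => a _.
rewrite !mulr_sumr; apply: eq_bigr => j _.
by rewrite !mulr_sumr; apply: eq_bigr => b _; ring.
Qed.

(** Squaring [enorm] leaves a polynomial in the entries of [Du u]. The chain rule then yields second
    derivatives of [u] contracted with the velocity, which [dotv_laplacian] recognizes. *)
Lemma is_derive_energy (xi : 'rV[R]_N) (g : R -> 'rV[R]_n) (t : R) :
  is_derive t 1 g (xi *m Du u (g t)) ->
  is_derive t 1 (fun s => enorm (Du u (g s)) ^+ 2)
    (2 * dotv xi (tangential_infty_laplacian u (g t))).
Proof.
move=> dg.
rewrite (_ : (fun s => _) = fun s => \sum_a \sum_i Du u (g s) a i ^+ 2); last first.
  apply/funext => s; rewrite sqr_sqrtr//.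
  by apply: sumr_ge0 => a _; apply: sumr_ge0 => i _; exact: sqr_ge0.
set v := xi *m _ in dg *.
rewrite (_ : 2 * _ = \sum_a \sum_j (2%:R * Du u (g t) a j ^+ 1) *:
    \sum_i partial i (partial j (component u a)) (g t) * v 0 i).
  apply: is_derive_sum_fun => a; apply: is_derive_sum_fun => j.
  have dDu : is_derive t 1 (fun s => Du u (g s) a j)
      (\sum_i partial i (partial j (component u a)) (g t) * v 0 i).
    rewrite (_ : (fun s => _) = partial j (component u a) \o g).
      exact: is_derive_comp_C1 (class_C2_partial (u_C2 a) j) dg.
    by apply/funext => s; rewrite mxE.
  exact: (@is_deriveX _ _ (fun s => Du u (g s) a j) 2 _ _ _ dDu).
rewrite dotv_laplacian mulr_sumr.
under [RHS]eq_bigr do under eq_bigr do rewrite scaler_sumr.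
rewrite exchange_big/=.
under [RHS]eq_bigr do rewrite exchange_big/=.
rewrite exchange_big/=; apply: eq_bigr => i _.
rewrite !mulr_sumr; apply: eq_bigr => j _.
rewrite !mulr_sumr; apply: eq_bigr => a _.
by rewrite /D2u /GRing.scale/=; ring.
Qed.

End Gradient.

(** * Mean values on an interval, and coordinate vectors *)

Lemma mvt_interval (R : realType) (f df : R -> R) (I : set R) (a b : R) :
  is_interval I -> (forall t : R, I t -> is_derive t 1 f (df t)) ->
  I a -> I b -> a < b -> exists2 c, I c & f b - f a = df c * (b - a).
Proof.
move=> iI fE Ia Ib ab.
have abI c : a <= c <= b -> I c by exact: iI.
have [t|t|c] := @MVT R f df a b ab.
- by rewrite in_itv/= => /andP[? ?]; apply/fE/abI; rewrite !ltW.
- apply: continuous_in_subspaceT t => t; rewrite inE/= in_itv/= => tab.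
  exact/is_derive_continuous/fE/abI.
- rewrite in_itv/= => /andP[ac cb] ->; exists c => //.
  by apply: abI; rewrite !ltW.
Qed.

Lemma dotv_gt0 (R : realType) (n : nat) (v : 'rV[R]_n) : v != 0 -> 0 < dotv v v.
Proof.
move=> v0; have p i : true -> 0 <= v 0 i * v 0 i by rewrite -expr2 sqr_ge0.
rewrite lt_def sumr_ge0// andbT; apply: contra v0 => /eqP.
move=> /(psumr_eq0P p) v0; apply/eqP/rowP => i; rewrite mxE.
by apply/eqP; have /eqP := v0 i isT; rewrite mulf_eq0 orbb.
Qed.

Lemma enorm_delta (R : realType) (n : nat) (a : 'I_n) :
  enorm (delta_mx 0 a : 'rV[R]_n) = 1.
Proof.
rewrite /enorm big_ord1 (bigD1 a)//= big1 => [|i ia].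
  by rewrite mxE !eqxx addr0 expr1n sqrtr1.
by rewrite mxE eqxx (negbTE ia) expr0n.
Qed.

Lemma dotv_delta (R : realType) (n : nat) (a : 'I_n) (v : 'rV[R]_n) :
  dotv (delta_mx 0 a) v = v 0 a.
Proof.
rewrite /dotv (bigD1 a)//= big1 => [|i ia].
  by rewrite mxE !eqxx mul1r addr0.
by rewrite mxE eqxx (negbTE ia) mul0r.
Qed.

(** * The equation and the behaviour of the flow *)

Unset Implicit Arguments.

Theorem proposition2p2 (R : realType) (n N : nat)
    (u : 'rV[R]_n -> 'rV[R]_N) (Omega : set 'rV[R]_n)
    (u_C2 : forall a : 'I_N, class_C 2 (component u a))
    (Omega_open : open Omega) (Omega_cc : compact (closure Omega)) :
  (forall x, Omega x -> tangential_infty_laplacian u x = 0)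
  <->
  (exists (J : 'rV[R]_n -> 'rV[R]_N -> set R)
          (Phi : R -> 'rV[R]_n -> 'rV[R]_N -> 'rV[R]_n),
    is_flow_map u Omega J Phi /\
    forall x xi, Xi u Omega (x, xi) ->
      (forall t, J x xi t -> enorm (Du u (Phi t x xi)) = enorm (Du u x)) /\
      (forall s t, J x xi s -> J x xi t -> s < t ->
         dotv xi (u (Phi s x xi)) < dotv xi (u (Phi t x xi)))).
Proof.
have lip xi := gradient_field_lipschitz u_C2 xi.
split=> [lap0|[J [Phi [flow incr]]] x Ox].
  (* A maximal solution is chosen for each point and direction; points outside [Omega] get a dummy
     pair. *)
  have maxP (p : 'rV[R]_n * 'rV[R]_N) : exists Jg : set R * (R -> 'rV[R]_n),
      Omega p.1 -> trajectory u Omega p.1 p.2 Jg.1 Jg.2 /\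
      forall I g, trajectory u Omega p.1 p.2 I g -> I `<=` Jg.1.
    have [Op|nOp] := pselect (Omega p.1); last by exists (set0, cst 0).
    have [J [g Jg]] := ode_maximal_solution (lip p.2) Omega_open Op.
    by exists (J, g).
  have [S SP] := choice maxP.
  exists (fun x xi => (S (x, xi)).1), (fun t x xi => (S (x, xi)).2 t).
  split=> [x xi [/= Ox _ _]|x xi [/= Ox _ v0]]; first exact: SP (x, xi) Ox.
  have [[oJ iJ J0 gx dg] _] := SP (x, xi) Ox.
  move: (S _).1 (S _).2 => J g /= in oJ iJ J0 gx dg *.
  have dgW t : J t -> is_derive t 1 g (xi *m Du u (g t)) by move=> /dg[].
  split.
    move=> t Jt; rewrite -gx.
    (* The trajectory stays in [Omega], where the Laplacian is zero. *)
    have dE s : J s -> is_derive s 1 (fun r => enorm (Du u (g r)) ^+ 2) 0.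
      move=> Js; have [Ogs dgs] := dg _ Js.
      have := is_derive_energy u_C2 dgs; rewrite lap0//.
      by rewrite (_ : dotv xi 0 = 0) ?mulr0// /dotv big1// => a _; rewrite mxE mulr0.
    have E a b : J a -> J b -> a < b -> enorm (Du u (g b)) = enorm (Du u (g a)).
      move=> Ja Jb ab; have [_ _] := mvt_interval iJ dE Ja Jb ab.
      rewrite mul0r => /eqP; rewrite subr_eq0 eqrXn2 ?sqrtr_ge0//.
      by move/eqP.
    by case: (ltgtP t 0) => [t0|t0|->//]; [rewrite (E t 0)|rewrite (E 0 t)].
  move=> s t Js Jt st.
  have [c Jc] := mvt_interval iJ (fun r Jr => is_derive_dotv u_C2 xi (dgW r Jr))
    Js Jt st.
  rewrite -subr_gt0 => ->; rewrite mulr_gt0 ?subr_gt0// dotv_gt0//.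
  (* If the field vanished at [g c], the constant curve there would be a solution, so [g] would
     equal it at time 0 and the field would vanish at [x]. *)
  apply: contra v0 => /eqP vc0; rewrite -gx.
  have -> : g 0 = g c; last by rewrite vc0.
  apply: (@ode_unique _ _ (fun y => xi *m Du u y) g (cst (g c)) J c) => // r _.
  by rewrite vc0; exact: is_derive_cst.
(* Testing with the coordinate vector [delta_mx 0 a], a unit vector, isolates component [a]. *)
apply/rowP => a; rewrite [RHS]mxE -dotv_delta.
have [v0|v0] := eqVneq (delta_mx 0 a *m Du u x : 'rV[R]_n) 0.
  by rewrite dotv_laplacian v0 big1// => i _; rewrite mxE mul0r.
have Xix : Xi u Omega (x, delta_mx 0 a) by split=> //=; exact: enorm_delta.
have [[oJ _ J0 Px dP] _] := flow _ _ Xix; have [E _] := incr _ _ Xix.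
have [_ d0] := dP _ J0; have [_ dE] := is_derive_energy u_C2 d0.
(* [J] is open and contains 0, so the energy is constant near time 0; its derivative there is also
   twice component [a] of the Laplacian at [x]. *)
have cE : is_derive (0 : R) 1
    (fun s : R => enorm (Du u (Phi s x (delta_mx 0 a))) ^+ 2) 0.
  apply: (near_eq_is_derive (f := cst (enorm (Du u x) ^+ 2))).
  have nJ : nbhs 0 (J x (delta_mx 0 a)) by exact: open_nbhs_nbhs.
  by apply: filterS nJ => t Jt /=; rewrite E.
move: dE; rewrite Px; have [_ ->] := cE; move/esym/eqP.
by rewrite mulf_eq0 pnatr_eq0/= => /eqP.
Qed.
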